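(* The sequence $\{U_{2n}\}_{n=1}^\infty$ is a Newton-Euler sequence, and the sequence $\{(-1)^nU_{2n}\}_{n=1}^\infty$ is realizable.
   Context: $[x]$ is the greatest integer not exceeding $x$. The sequence $\{U_n\}_{n\ge0}$ is defined by $U_0=1$ and $U_n=-2\sum_{k=1}^{[n/2]}\binom n{2k}U_{n-2k}$ for $n\ge1$. If $\{a_n\}_{n=1}^\infty$ and $\{b_n\}_{n=1}^\infty$ are two sequences satisfying $a_1=b_1$ and $b_n+a_1b_{n-1}+\cdots+a_{n-1}b_1=na_n$ for $n>1$, then $(a_n,b_n)$ is called a Newton-Euler pair; if moreover $a_n\in\mathbb Z$ for all $n=1,2,3,\ldots$, then $\{b_n\}$ is called a Newton-Euler sequence. A sequence $\{b_n\}_{n=1}^\infty$ of nonnegative integers is called realizable if there is a set $X$ and a map $T:X\to X$ such that, for every $n\ge1$, $b_n$ is the number of fixed points of $T^n$. *)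

(* Defs.v *)
From HB Require Import structures.
From mathcomp Require Import all_boot all_order all_algebra.
From mathcomp Require Import all_classical.
From mathcomp Require Import zify.

Set Implicit Arguments.
Unset Strict Implicit.
Unset Printing Implicit Defensive.

Import Order.TTheory GRing.Theory Num.Theory.
Local Open Scope classical_set_scope.
Local Open Scope card_scope.
Local Open Scope ring_scope.

(* [U_prefix n] is the list U_0, ..., U_n; the course-of-values recursion
   defining U is recovered in [U0] and [U_rec]. *)
Fixpoint U_prefix (n : nat) : seq int :=
  if n is m.+1 then
    let s := U_prefix m in
    rcons s (- 2 * \sum_(1 <= k < n./2.+1) 'C(n, 2 * k)%:Z * s`_(n - 2 * k))
  else [:: 1].

Definition U (n : nat) : int := (U_prefix n)`_n.

Lemma size_U_prefix n : size (U_prefix n) = n.+1.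
Proof. by elim: n => //= n IHn; rewrite size_rcons IHn. Qed.

Lemma nth_U_prefix n i : (i <= n)%N -> (U_prefix n)`_i = U i.
Proof.
elim: n => [|n IHn]; first by case: i.
rewrite leq_eqVlt => /predU1P[-> //|lt_in].
by rewrite /= nth_rcons size_U_prefix lt_in IHn.
Qed.

Lemma U0 : U 0 = 1.
Proof. by []. Qed.

Lemma U_rec n : (1 <= n)%N ->
  U n = - 2 * \sum_(1 <= k < n./2.+1) 'C(n, 2 * k)%:Z * U (n - 2 * k).
Proof.
case: n => // n _.
rewrite {1}/U [U_prefix _]/= nth_rcons size_U_prefix ltnn eqxx; congr (_ * _).
rewrite !big_nat; apply: eq_bigr => k /andP[k_gt0 _].
by rewrite nth_U_prefix //; lia.
Qed.

(* Sequences indexed by n >= 1 are functions on nat whose value at 0 is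
   irrelevant. *)
Definition newton_euler_pair (R : numDomainType) (a b : nat -> R) : Prop :=
  a 1%N = b 1%N /\
  forall n : nat, (1 < n)%N ->
    b n + \sum_(1 <= k < n) a k * b (n - k)%N = n%:R * a n.

Definition newton_euler_seq (R : numDomainType) (b : nat -> R) : Prop :=
  exists a : nat -> int, newton_euler_pair (fun n => (a n)%:~R) b.

(* [X] may be infinite; the condition at n forces b n to be nonnegative and the
   set of fixed points of the n-th iterate of [T] to be finite. *)
Definition realizable (b : nat -> int) : Prop :=
  exists (X : Type) (T : X -> X), forall n : nat, (1 <= n)%N ->
    exists2 m : nat, b n = m%:Z & [set x | iter n T x = x] #= `I_m.

(* Main.v *)
(* Let g_n(y) = sum_i C(n,i) U_i y^(n-i).  Umbrally, the recursion for U reads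
   g_n(y+2) - g_n(y+1) + g_n(y) = (y+1)^n.  If x^n = x^n' mod q for all x, then
   D = g_n - g_n' satisfies D(y+2) - D(y+1) + D(y) = 0 mod q, so D is
   6-periodic mod q, besides being q-periodic; unless 6 divides q this forces
   D(0) = U_n - U_n' = 0 mod q.  With q = p^(k+1), n = 2 p^(k+1) m and
   n' = 2 p^k m, this is the Gauss congruence b(p^(k+1) m) = b(p^k m) mod p^(k+1)
   for b_n = U_2n, and also for b_n = (-1)^n U_2n as U_2n is even.
   The Gauss congruences give integers o_d with b_n = sum_(d | n) d o_d.  Then
   the coefficients of prod_d (1 - x^d)^(-o_d) = exp(sum_n b_n x^n / n) form an
   integral Newton-Euler partner of b; and if all o_d >= 0, then b counts the
   periodic points of a permutation with o_d cycles of length d for every d.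
   Nonnegativity of o_d for b_n = (-1)^n U_2n follows from the growth
   b_n >= C(2n,2) b_(n-1). *)

Require Import Defs.
From HB Require Import structures.
From mathcomp Require Import all_boot all_order all_algebra.
From mathcomp Require Import cyclic classical_sets cardinality zify ring.

Set Implicit Arguments.
Unset Strict Implicit.
Unset Printing Implicit Defensive.

Import Order.TTheory GRing.Theory Num.Theory.
Local Open Scope ring_scope.

(** * Congruences for U *)

(** Umbral evaluation X^i -> U_i: as a linear functional it turns binomial sums over [U] into values
    at powers of [X] plus a constant. *)
Definition umbral (p : {poly int}) : int := \sum_(i < size p) p`_i * U i.

Lemma umbral_widen n (p : {poly int}) : (size p <= n)%N ->
  umbral p = \sum_(i < n) p`_i * U i.
Proof.
move=> le_pn; rewrite /umbral (big_ord_widen n (fun i => p`_i * U i)) //.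
rewrite big_mkcond; apply: eq_bigr => i _.
by case: ltnP => // le_pi; rewrite nth_default ?mul0r.
Qed.

Lemma umbral_is_linear : linear_for *%R umbral.
Proof.
move=> c p q; set n := maxn (size p) (size q).
rewrite !(@umbral_widen n) ?leq_maxl ?leq_maxr //; last first.
  by rewrite (leq_trans (size_polyD _ _)) // geq_max (leq_trans (size_scale_leq _ _))
    ?leq_maxl ?leq_maxr.
rewrite mulr_sumr -big_split; apply: eq_bigr => i _ /=.
by rewrite coefD coefZ mulrDl mulrA.
Qed.

HB.instance Definition _ :=
  GRing.isLinear.Build int {poly int} int *%R umbral umbral_is_linear.

Lemma umbral_Xn n : umbral 'X^n = U n.
Proof.
rewrite /umbral size_polyXn big_ord_recr /= coefXn eqxx mul1r big1 ?add0r //.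
by move=> i _; rewrite coefXn ltn_eqF ?mul0r.
Qed.

Lemma umbral_XD_exp n (c : int) :
  umbral (('X + c%:P) ^+ n) = \sum_(i < n.+1) c ^+ i * ('C(n, i)%:Z * U (n - i)).
Proof.
rewrite exprDn linear_sum; apply: eq_bigr => i _ /=.
rewrite raddfMn /= -polyC_exp mulrC mul_polyC linearZ /= umbral_Xn.
by rewrite -mulr_natl natz mulrCA.
Qed.

Lemma sum_even (V : nmodType) (F : nat -> V) n :
  \sum_(0 <= i < n.+1 | ~~ odd i) F i = \sum_(0 <= k < n./2.+1) F (2 * k)%N.
Proof.
elim: n => [|n IHn]; first by rewrite big_mkcond !big_nat1.
rewrite big_mkcond big_nat_recr //= -big_mkcond IHn /= uphalf_half.
case: (boolP (odd n)) => n_odd /=; last by rewrite addr0.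
rewrite add1n [RHS]big_nat_recr //=; congr (_ + F _).
by rewrite mul2n -[in LHS](odd_double_half n) n_odd.
Qed.

(* This is the identity U(t) (e^t + e^-t - 1) = 1 of exponential generating
   functions. *)
Lemma umbral_second_difference (p : {poly int}) :
  umbral (p \Po ('X + 1%:P)) + umbral (p \Po ('X + (-1)%:P)) - umbral p = p.[0].
Proof.
rewrite -(coefK p) poly_def !linear_sum /= horner_sum -big_split -sumrB.
apply: eq_bigr => -[i /= _] _; move: (p`_i) => c {p}.
rewrite !linearZ /= !comp_Xn_poly hornerZ hornerXn.
rewrite !umbral_XD_exp umbral_Xn -!mulrDr -mulrBr; congr (_ * _).
rewrite -big_split /= -(big_mkord xpredT (fun j =>
   1 ^+ j * ('C(i, j)%:Z * U (i - j)) + (-1) ^+ j * ('C(i, j)%:Z * U (i - j)))).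
(* Odd powers of 1 and -1 cancel, even ones double. The term j = 0 then gives 2 U_i, and for i > 0
   the recursion makes the others sum to -U_i. *)
rewrite (eq_bigr (fun j => if ~~ odd j then 2 * ('C(i, j)%:Z * U (i - j)) else 0));
  last by move=> j _; rewrite -signr_odd expr1n; case: odd => /=; ring.
rewrite -big_mkcond sum_even -mulr_sumr big_nat_recl // bin0 subn0 mul1r.
case: i => [|i]; first by rewrite big_geq // U0.
by rewrite (@U_rec i.+1) // big_add1 /= expr0n /=; ring.
Qed.

(* The Appell polynomial sum_i C(n,i) U_i y^(n-i). *)
Definition Uat n (y : nat) : int := umbral (('X + (y%:Z)%:P) ^+ n).

Lemma Uat0 n : Uat n 0 = U n.
Proof. by rewrite /Uat addr0 umbral_Xn. Qed.

Lemma Uat_shift n (y : nat) : Uat n y.+2 - Uat n y.+1 + Uat n y = (y.+1%:Z) ^+ n.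
Proof.
have := umbral_second_difference (('X + (y.+1%:Z)%:P) ^+ n).
rewrite !rmorphXn /= !comp_polyD !comp_polyX !comp_polyC horner_exp !hornerE.
rewrite -!addrA -!polyCD => <-.
have ->: 1 + y.+1%:Z = y.+2%:Z by lia.
have ->: -1 + y.+1%:Z = y%:Z by lia.
by rewrite /Uat; ring.
Qed.

(** The difference of the two n-th powers is a polynomial multiple of the difference of their bases,
    the constant q. *)
Lemma Uat_period n q y : (q %| Uat n (y + q) - Uat n y)%Z.
Proof.
rewrite /Uat -linearB /= subrXX.
have ->: 'X + ((y + q)%N%:Z)%:P - ('X + (y%:Z)%:P) = (q%:Z)%:P :> {poly int}.
  by rewrite PoszD polyCD; ring.
by rewrite mul_polyC linearZ /= dvdz_mulr.
Qed.

Lemma U_congruence (q n n' : nat) : ~~ (6 %| q)%N ->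
    (forall x : nat, (q %| x%:Z ^+ n - x%:Z ^+ n')%Z) ->
  (q %| U n - U n')%Z.
Proof.
move=> q6 eq_pow; pose D y := Uat n y - Uat n' y.
rewrite -!Uat0 -/(D 0%N).
have shift y : (q %| D y.+2 - D y.+1 + D y)%Z.
  have := eq_pow y.+1; rewrite -!Uat_shift; congr (_ %| _)%Z; rewrite /D; ring.
have period y : (q %| D (y + q)%N - D y)%Z.
  have := rpredB (Uat_period n q y) (Uat_period n' q y).
  by rewrite -[_ \in _]/(_ %| _)%Z; congr (_ %| _)%Z; rewrite /D; ring.
have comb (a b c : int) : (q %| a)%Z -> (q %| b)%Z -> (a + b = c) -> (q %| c)%Z.
  by move=> da db <-; apply: rpredD.
(* Adding the relations at y and y + 1 leaves D(y+3) + D(y). *)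
have anti y : (q %| D (y + 3)%N + D y)%Z.
  by apply: comb (shift y) (shift y.+1) _; rewrite addn3; ring.
have per6 y : (q %| D (y + 6)%N - D y)%Z.
  have := rpredB (anti (y + 3)%N) (anti y).
  by rewrite -addnA -[_ \in _]/(_ %| _)%Z; congr (_ %| _)%Z; ring.
have per6k j y : (q %| D (6 * j + y)%N - D y)%Z.
  elim: j => [|j IHj]; first by rewrite subrr dvdz0.
  rewrite mulnS [(6 + _)%N]addnC addnAC; apply: comb (per6 _) IHj _; ring.
have perk j y : (q %| D (q * j + y)%N - D y)%Z.
  elim: j => [|j IHj]; first by rewrite muln0 subrr dvdz0.
  rewrite mulnS [(q + _)%N]addnC addnAC; apply: comb (period _) IHj _; ring.
have eqD j k y z : (q * j + y = 6 * k + z)%N -> (q %| D y - D z)%Z.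
  move=> e; have := rpredB (per6k k z) (perk j y); rewrite e.
  by rewrite -[_ \in _]/(_ %| _)%Z; congr (_ %| _)%Z; ring.
(* For odd q, 3 q = 3 mod 6, so D(0) = D(3) = -D(0) mod q, and 2 is invertible mod q. *)
have [q_odd | q_even] := boolP (odd q).
  have d03 := eqD 3 q./2 0%N 3%N ltac:(lia).
  have : (q %| 2 * D 0%N)%Z by apply: comb d03 (anti 0%N) _; rewrite add0n; ring.
  by rewrite Gauss_dvdzr // coprimezE /= coprimen2.
(* For even q prime to 3, the multiples of q reach 2 and 4 mod 6, so D(0) = D(2) = D(4) mod q; the
   relation at 0 then gives 3 D(0) = 0, with 3 invertible. *)
have {q6} q3 : ~~ (3 %| q)%N by lia.
have [d02 d04] : (q %| D 0%N - D 2%N)%Z /\ (q %| D 0%N - D 4%N)%Z.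
  have [q2 | q4] : (q %% 6 = 2 \/ q %% 6 = 4)%N by lia.
    by split; [apply: (eqD 1%N (q %/ 6)%N) | apply: (eqD 2%N (q %/ 6 * 2)%N)]; lia.
  by split; [apply: (eqD 2%N (q %/ 6 * 2).+1%N) | apply: (eqD 1%N (q %/ 6)%N)]; lia.
have : (q %| 3 * D 0%N)%Z.
  have d024 := rpredD d02 d04.
  have := rpredD (shift 0%N) (rpredD d024 (anti 1%N)).
  by rewrite -[_ \in _]/(_ %| _)%Z; congr (_ %| _)%Z; ring.
by rewrite Gauss_dvdzr // coprimezE /= coprime_sym prime_coprime.
Qed.

(** If p divides x, both sides vanish because p^k > k. Otherwise Euler's theorem applies, as the
    exponents differ by the totient of p^(k+1). *)
Lemma expn_prime_pow_congr p k x : prime p -> x ^ (p ^ k.+1) = x ^ (p ^ k) %[mod p ^ k.+1].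
Proof.
move=> p_pr; have p_gt1 := prime_gt1 p_pr.
have [/dvdnP[y ->] | p'x] := boolP (p %| x)%N.
  have kp : (k < p ^ k)%N by apply: ltn_expl.
  have z m : (k < m)%N -> (y * p) ^ m = 0 %[mod p ^ k.+1].
    by move=> km; apply/eqP; rewrite eqn_mod_dvd // subn0 expnMn dvdn_mull // dvdn_exp2l.
  by rewrite !z // (leq_trans kp) // leq_exp2l.
have cop : coprime x (p ^ k.+1) by rewrite coprime_sym coprimeXl // prime_coprime.
have e : (p ^ k.+1 = totient (p ^ k.+1) + p ^ k)%N.
  by rewrite totient_pfactor //= expnS -{1}(prednK (prime_gt0 p_pr)) mulSn addnC.
by rewrite {1}e expnD -modnMml Euler_exp_totient // modnMml mul1n.
Qed.

Definition gauss_congruences (b : nat -> int) : Prop :=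
  forall p k m, prime p -> (0 < m)%N ->
    ((p ^ k.+1)%N %| b (p ^ k.+1 * m)%N - b (p ^ k * m)%N)%Z.

Lemma gauss_U : gauss_congruences (fun n => U (2 * n)).
Proof.
move=> p k m p_pr _; apply: U_congruence.
  apply/negP => d6.
  have d q : prime q -> (q %| 6)%N -> q = p.
    move=> q_pr q6; have := dvdn_trans q6 d6.
    by rewrite Euclid_dvdX // dvdn_prime2 //= => /andP[/eqP].
  by have := d 2%N isT isT; rewrite -(d 3%N).
move=> x; rewrite -eqz_mod_dvd -!natz -!natrX !natz !modz_nat; apply/eqP; congr Posz.
by rewrite !mulnA ![(2 * _)%N]mulnC -!mulnA !(expnM x) -modnXm expn_prime_pow_congr // modnXm.
Qed.

(** * Gauss congruences and Newton-Euler sequences *)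

Lemma exists_by_recursion (T : Type) (x0 : T) (F : nat -> (nat -> T) -> T) :
    (forall n f g, (forall i, (i < n)%N -> f i = g i) -> F n f = F n g) ->
  exists f, forall n, f n = F n f.
Proof.
move=> F_ext.
(* [h n] is a table that is correct below n, with [x0] as filler; the solution is read off the
   diagonal. *)
pose h := fix h n := if n is m.+1 then
  fun i => if i == m then F m (h m) else h m i else fun=> x0.
have h_stable m d i : (i < m)%N -> h (d + m)%N i = h m i.
  move=> lt_im; elim: d => //= d ->; case: eqP => // i_eq; lia.
exists (fun n => h n.+1 n) => n /=; rewrite eqxx; apply: F_ext => i lt_in /=.
by rewrite -[n in LHS](subnK lt_in) h_stable.
Qed.

(** The cofactor n / d is prime to p, since otherwise d would divide n / p; hence p^(k+1) must
    divide d. *)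
Lemma dvdn_div_prime p k n d : prime p -> (p ^ k.+1 %| n)%N -> (d %| n)%N ->
  ~~ (d %| n %/ p)%N -> (p ^ k.+1 %| d)%N.
Proof.
move=> p_pr pn /dvdnP[e n_eq]; rewrite n_eq in pn *.
have [/dvdnP[e' ->] | p'e] := boolP (p %| e)%N.
  by rewrite mulnAC mulnK ?prime_gt0 // dvdn_mull.
by rewrite -(@Gauss_dvdr (p ^ k.+1) e) // coprimeXl // prime_coprime.
Qed.

(** Solving for o_n requires dividing by n. Exactness is checked one prime power at a time: the
    divisors of n / p contribute b(n / p), by induction, and all other proper divisors are multiples
    of the full power of p in n. *)
Lemma gauss_divisor_sum b : gauss_congruences b -> exists o : nat -> int,
  forall n, (0 < n)%N -> b n = \sum_(0 <= d < n.+1 | (d %| n)%N) d%:Z * o d.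
Proof.
move=> gb; have [|o o_rec] := @exists_by_recursion int 0 (fun n o =>
    ((b n - \sum_(0 <= d < n | (d %| n)%N) d%:Z * o d) %/ n%:Z)%Z).
  move=> n f g fg; congr ((_ - _) %/ _)%Z; rewrite big_nat_cond [RHS]big_nat_cond.
  by apply: eq_bigr => d /andP[/andP[_ /fg->]].
exists o => n; have [m] := ubnP n; elim: m n => // m IHm n /ltnSE-le_nm n_gt0.
suff dvd_n : (n %| b n - \sum_(0 <= d < n | (d %| n)%N) d%:Z * o d)%Z.
  rewrite big_mkcond big_nat_recr //= dvdnn -big_mkcond /=.
  by rewrite (o_rec n) mulrC divzK // addrC subrK.
rewrite dvdzE; apply/dvdn_partP => // p; rewrite mem_primes => /and3P[p_pr _ p_n].
set z := b n - _; rewrite p_part.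
suff : ((p ^ logn p n)%N %| z)%Z by rewrite dvdzE.
have := p_n; rewrite -{1}[p]expn1 pfactor_dvdn //; case v_eq: (logn p n) => [//|k] _.
have pk_n : (p ^ k.+1 %| n)%N by rewrite -v_eq pfactor_dvdnn.
have np_gt0 : (0 < n %/ p)%N by rewrite divn_gt0 ?prime_gt0 // dvdn_leq.
have np_lt : (n %/ p < n)%N by rewrite ltn_Pdiv // prime_gt1.
rewrite /z.
have -> : \sum_(0 <= d < n | (d %| n)%N) d%:Z * o d = b (n %/ p)%N +
    \sum_(0 <= d < n | (d %| n)%N && ~~ (d %| n %/ p)%N) d%:Z * o d.
  rewrite (bigID (fun d => (d %| n %/ p)%N)) /=; congr (_ + _).
  rewrite IHm ?(leq_trans np_lt) // [RHS](big_nat_widen _ _ n) //.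
  rewrite big_nat_cond [RHS]big_nat_cond; apply: eq_bigl => d; rewrite ltnS.
  have [d_np | ] := boolP (d %| n %/ p)%N; last by rewrite !andbF.
  by rewrite (dvdn_trans d_np (dvdn_div p_n)) (dvdn_leq np_gt0 d_np).
rewrite opprD addrA; apply: rpredB.
  have /dvdnP[m' n_eq] := pk_n.
  have m'_gt0 : (0 < m')%N by move: n_gt0; rewrite n_eq; case: m' {n_eq}.
  have np_eq : (n %/ p = p ^ k * m')%N.
    by rewrite n_eq expnSr mulnA mulnK ?prime_gt0 // mulnC.
  by have := gb p k m' p_pr m'_gt0; rewrite -np_eq mulnC -n_eq.
apply: rpred_sum => d /andP[d_n d'n]; apply: dvdz_mulr.
by rewrite dvdzE /= (dvdn_div_prime p_pr pk_n).
Qed.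

(* With B = sum_(i >= 1) b_i X^i, the relation X A' = A B says that the
   coefficients of A and b form a Newton-Euler pair; here modulo X^(n+1). *)
Definition truncated_pair n (A B : {poly int}) : Prop :=
  A`_0 = 1 /\ exists R : {poly int}, 'X * A^`() - A * B = 'X ^+ n.+1 * R.

(** Logarithmic derivatives X A' / A add under multiplication. *)
Lemma truncated_pairM n A B A' B' : truncated_pair n A B ->
  truncated_pair n A' B' -> truncated_pair n (A * A') (B + B').
Proof.
move=> [A0 [R eR]] [A'0 [R' eR']]; split; first by rewrite coef0M A0 A'0 mulr1.
exists (R * A' + A * R').
rewrite derivM mulrDr (_ : _ - _ = ('X * A^`() - A * B) * A' +
  A * ('X * A'^`() - A' * B')); last by ring.
by rewrite eR eR'; ring.
Qed.

Lemma truncated_pairV n A B C S : truncated_pair n A B ->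
  A * C = 1 + 'X ^+ n.+1 * S -> truncated_pair n C (- B).
Proof.
move=> [A0 [R eR]] AC; split.
  have := congr1 (fun p : {poly int} => p`_0) AC.
  by rewrite coef0M coefD coef1 coefXnM A0 mul1r addr0.
(* Differentiation costs one power of X; the factor X in the logarithmic derivative restores it. *)
have eD : A^`() * C + A * C^`() = 'X^n * (n.+1%:R * S + 'X * S^`()).
  rewrite -derivM AC derivD derivM derivXn -{1}[1]/(1%:P) derivC add0r /=.
  by rewrite exprS -mulr_natl; ring.
exists ((n.+1%:R * S + 'X * S^`()) * C - R * C ^+ 2 -
  S * ('X * C^`() + B * C)).
have {}eD : 'X * C * (A^`() * C + A * C^`()) =
    'X ^+ n.+1 * ((n.+1%:R * S + 'X * S^`()) * C) by rewrite eD exprS; ring.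
transitivity ('X * C * (A^`() * C + A * C^`()) - C ^+ 2 * ('X * A^`() - A * B)
   - (A * C - 1) * ('X * C^`() + B * C)); first by ring.
by rewrite eD eR AC; ring.
Qed.

(** The inverse of 1 - X^d modulo X^(n+1), for d > 0. *)
Definition geometric n d : {poly int} := \sum_(i < n.+1) 'X^(d * i).

Lemma geometricP n d :  (1 - 'X^d) * geometric n d = 1 - 'X^(d * n.+1).
Proof.
rewrite exprM -[in RHS](expr1n _ n.+1) subrXX; congr (_ * _).
by apply: eq_bigr => i _; rewrite expr1n mul1r -exprM.
Qed.

Lemma truncated_pair_geometric n d : (0 < d)%N ->
  truncated_pair n (1 - 'X^d) (- d%:R * (geometric n d - 1)) /\
  truncated_pair n (geometric n d) (d%:R * (geometric n d - 1)).
Proof.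
move=> d_gt0; have eXn : 'X^(d * n.+1) = 'X ^+ n.+1 * 'X^(d.-1 * n.+1) :> {poly int}.
  by rewrite -exprD -mulSn prednK.
have eXd : 'X * 'X ^+ d.-1 = 'X^d :> {poly int} by rewrite -exprS prednK.
have P1 : truncated_pair n (1 - 'X^d) (- d%:R * (geometric n d - 1)).
  split; first by rewrite coefB coef1 coefXn (ltn_eqF d_gt0) subr0.
  exists (- d%:R * 'X^(d.-1 * n.+1)).
  rewrite derivB derivXn -{1}[1]/(1%:P) derivC sub0r.
  rewrite -[_ *+ d]mulr_natl.
  transitivity (d%:R * ((1 - 'X^d) * geometric n d - 1) +
      d%:R * ('X^d - 'X * 'X ^+ d.-1) : {poly int}); first by ring.
  by rewrite geometricP eXn eXd; ring.
split=> //; rewrite -[d%:R]opprK mulNr.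
by apply: (truncated_pairV P1 (S := - 'X^(d.-1 * n.+1))); rewrite geometricP eXn; ring.
Qed.

(** [A] is the product of the (1 - X^d)^(-o_d) for d <= m. It has integer coefficients for either
    sign of o_d: powers of [geometric] serve for o_d >= 0, powers of 1 - X^d for o_d < 0. *)
Lemma truncated_pair_prod n (o : nat -> int) m : exists A, truncated_pair n A
  (\sum_(1 <= d < m.+1) (o d)%:~R * d%:R * (geometric n d - 1)).
Proof.
have pairX A B k : truncated_pair n A B -> truncated_pair n (A ^+ k) (k%:R * B).
  move=> AB; elim: k => [|k IHk].
    by rewrite mul0r; split; [rewrite coef1 | exists 0; rewrite derivC; ring].
  by rewrite exprS -natr1 mulrDl mul1r addrC; apply: truncated_pairM.
elim: m => [|m [A PA]].
  by exists 1; rewrite big_geq //; split; [rewrite coef1 | exists 0; rewrite derivC; ring].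
rewrite big_nat_recr //=; have [Pn Pp] := truncated_pair_geometric n (ltn0Sn m).
case: (o m.+1) => k.
  by exists (A * geometric n m.+1 ^+ k); apply: truncated_pairM => //; rewrite -mulrA; apply: pairX.
exists (A * (1 - 'X ^+ m.+1) ^+ k.+1); apply: truncated_pairM => //.
have := pairX _ _ k.+1 Pn; congr truncated_pair.
by rewrite NegzE rmorphN /=; ring.
Qed.

Lemma coef_geometric n d i : (0 < d)%N -> (0 < i <= n)%N ->
  (geometric n d - 1)`_i = (d %| i)%:R.
Proof.
move=> d_gt0 /andP[i_gt0 le_in]; rewrite coefB coef1 gtn_eqF // subr0 coef_sum.
have [/dvdnP[j i_eq] | d'i] := boolP (d %| i)%N; last first.
  rewrite big1 // => j _; rewrite coefXn; case: eqP => // i_eq.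
  by rewrite i_eq dvdn_mulr in d'i.
have lt_jn : (j < n.+1)%N by rewrite ltnS (leq_trans _ le_in) // i_eq leq_pmulr.
rewrite (bigD1 (Ordinal lt_jn)) //= i_eq mulnC coefXn eqxx big1 ?addr0 // => j' neq.
rewrite coefXn [(j * d)%N]mulnC eqn_pmul2l //; case: eqP => // j_eq.
by case/eqP: neq; apply: val_inj.
Qed.

Lemma gauss_newton_euler b : gauss_congruences b -> newton_euler_seq b.
Proof.
move=> /gauss_divisor_sum[o b_eq].
have trunc n : exists2 A : {poly int}, A`_0 = 1 & forall i, (0 < i <= n)%N ->
    i%:Z * A`_i = \sum_(0 <= k < i) A`_k * b (i - k)%N.
  have [A [A0 [R eA]]] := truncated_pair_prod n o n.
  exists A => // i /andP[i_gt0 le_in].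
  have := congr1 (fun p : {poly int} => p`_i) eA.
  rewrite coefB coefXnM ltnS le_in => /eqP; rewrite subr_eq0 => /eqP.
  rewrite coefXM gtn_eqF // coef_deriv prednK // -mulr_natl natz => ->.
  rewrite coefM big_ord_recr /= subnn.
  set B := \sum_(1 <= d < _) _.
  have coef_term d j : ((o d)%:~R * d%:R * (geometric n d - 1))`_j =
      o d * d%:Z * (geometric n d - 1)`_j.
    by rewrite -mulrA mulrzl mulr_natl coefMrz coefMn mulrzz -mulr_natr natz; ring.
  (* The vanishing constant term of [B] removes the summand k = i; in degree j the summands with d >
     j vanish, as d does not divide j. *)
  have BE j : (j <= n)%N -> B`_j = if j is 0 then 0 else b j.
    rewrite coef_sum; case: j => [|j] lt_jn.
      rewrite big_nat big1 // => d /andP[d_gt0 _].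
      rewrite coef_term coefB coef_sum big_ord_recl muln0 !coefXn big1 ?addr0 ?subrr ?mulr0 //.
      by move=> i' _; rewrite coefXn ltn_eqF // muln_gt0 d_gt0.
    rewrite b_eq // [RHS]big_mkcond big_ltn //= add0r.
    rewrite (big_cat_nat (n := j.+2)) //= [X in _ + X]big_nat [X in _ + X]big1 ?addr0.
      rewrite !big_nat; apply: eq_bigr => d /andP[d_gt0 _].
      by rewrite coef_term coef_geometric //; case: (d %| j.+1)%N; rewrite ?mulr1 ?mulr0 1?mulrC.
    move=> d /andP[lt_jd _]; rewrite coef_term coef_geometric ?(leq_trans _ lt_jd) //.
    by rewrite gtnNdvd // mulr0.
  rewrite BE // mulr0 addr0 -(big_mkord xpredT (fun k => A`_k * B`_(i - k))).
  rewrite !big_nat; apply: eq_bigr => k /= lt_ki; rewrite BE; last by lia.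
  by case e: (i - k)%N => //; lia.
(* The polynomials [A] depend on n, so one sequence is defined by the recursion with integer
   division; comparison with [A] shows each division exact. *)
have [|a a_rec] := @exists_by_recursion int 0 (fun n a =>
    if n is 0 then 1 else ((\sum_(0 <= k < n) a k * b (n - k)%N) %/ n%:Z)%Z).
  case=> // n f g fg; congr (_ %/ _)%Z; rewrite big_nat [RHS]big_nat.
  by apply: eq_bigr => d /andP[_ /fg->].
have aE n : (0 < n)%N -> n%:Z * a n = \sum_(0 <= k < n) a k * b (n - k)%N.
  move=> n_gt0; have [A A0 A_rec] := trunc n.
  have aA i : (i <= n)%N -> a i = A`_i.
    have [m] := ubnP i; elim: m i => // m IHm [|i] /ltnSE-le_im le_in; first by rewrite A0 a_rec.
    rewrite a_rec (_ : \sum_(0 <= k < _) _ = i.+1%:Z * A`_i.+1) ?mulKz // A_rec //.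
    rewrite !big_nat; apply: eq_bigr => k /andP[_ lt_ki].
    by rewrite IHm // ?(leq_trans lt_ki) // ltnW // (leq_trans lt_ki).
  rewrite aA // A_rec ?n_gt0 ?leqnn // !big_nat; apply: eq_bigr => k /andP[_ /ltnW/aA->] //.
have a0 : a 0%N = 1 by rewrite a_rec.
exists a; split; first by have := aE 1%N isT; rewrite big_nat1 a0 !mul1r intz.
move=> n n_gt1; have n_gt0 := ltnW n_gt1.
rewrite natz intz aE // [RHS]big_ltn // a0 mul1r subn0; congr (_ + _).
by apply: eq_bigr => k _; rewrite intz.
Qed.

(** * Realizability *)

Lemma card_eq_image_pred (F : finType) (P : pred F) X (g : F -> X) : injective g ->
  ((g @` [set x | P x])%classic #= `I_#|P|)%card.
Proof.
move=> g_inj; rewrite (card_eqr card_II).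
pose h (i : 'I_#|P|) := g (enum_val i).
have -> : (g @` [set x | P x] = h @` [set: 'I_#|P|])%classic.
  apply/seteqP; split=> [_ [x Px <-] | _ [i _ <-]].
    by exists (enum_rank_in Px x); rewrite // /h enum_rankK_in.
  by exists (enum_val i) => //; apply: enum_valP.
by apply: inj_card_eq => i j _ _ /g_inj/enum_val_inj.
Qed.

Lemma iter_ordS_fixed d (j : 'I_d.+1) n : (iter n (@ordS d.+1) j == j) = (d.+1 %| n)%N.
Proof.
have iterE : iter n (@ordS d.+1) j = ((j + n) %% d.+1)%N :> nat.
  elim: n => [|n IHn] /=; first by rewrite addn0 modn_small.
  by rewrite IHn -addn1 modnDml addn1 addnS.
rewrite -val_eqE /= iterE -[X in _ == X](modn_small (ltn_ord j)) -[X in _ == (X %% _)%N]addn0.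
by rewrite eqn_modDl mod0n.
Qed.

Lemma orbit_counts_realizable (b : nat -> int) (o : nat -> nat) :
    (forall n, (0 < n)%N ->
      b n = (\sum_(0 <= d < n.+1 | (d %| n)%N) d * o d)%N%:Z) ->
  realizable b.
Proof.
(* Indices are shifted: [C d] consists of o_(d+1) cycles of length d + 1, which [T] rotates. *)
move=> b_eq; pose C d := ('I_(o d.+1) * 'I_d.+1)%type.
pose T (x : {d : nat & C d}) : {d : nat & C d} :=
  existT C (tag x) ((tagged x).1, ordS (tagged x).2).
have iterT n d (y : C d) :
    iter n T (existT C d y) = existT C d (y.1, iter n (@ordS d.+1) y.2).
  by elim: n => [|n /= ->] //; case: y.
exists {d : nat & C d}, T => n n_gt0.
exists (\sum_(0 <= d < n.+1 | (d %| n)%N) d * o d)%N; first exact: b_eq.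
(* A fixed point of the n-th iterate lies on a cycle whose length divides n, hence is at most n, so
   a finite part of the space suffices for counting. *)
pose P (x : {d : 'I_n & C d}) := ((tag x).+1 %| n)%N.
pose g (x : {d : 'I_n & C d}) := existT C (tag x) (tagged x).
have g_inj : injective g.
  move=> [[d lt_d] y] [[d' lt_d'] y'] e.
  have ed : d = d' := congr1 (@projT1 _ _) e.
  subst d'; rewrite (bool_irrelevance lt_d' lt_d) in y' e *.
  by have /= <- := eq_from_Tagged e.
have -> : (\sum_(0 <= d < n.+1 | (d %| n)%N) d * o d = #|P|)%N.
  rewrite big_mkcond big_nat_recl //= mul0n if_same add0n -big_mkcond big_mkord.
  rewrite -sum1_card (eq_bigl (fun x : {d : 'I_n & C d} => ((tag x).+1 %| n)%N && true));
    last first.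
    by move=> x; rewrite andbT.
  rewrite -(@sig_big_dep _ _ _ _ _ (fun d : 'I_n => (d.+1 %| n)%N)
    (fun d _ => true) (fun _ _ => 1%N)).
  by apply: eq_bigr => d _; rewrite sum1_card card_prod !card_ord mulnC.
rewrite (_ : [set x | _]%classic = (g @` [set x | P x])%classic).
  exact: card_eq_image_pred.
apply/seteqP; split=> [[d [i j]] /= | _ [[d [i j]] Pd <-]] /=; rewrite /= iterT /=.
  move=> e; have := eq_from_Tagged e => -[/eqP]; rewrite iter_ordS_fixed => d_n.
  have lt_dn : (d < n)%N by apply: dvdn_leq.
  by exists (existT (fun d : 'I_n => C d) (Ordinal lt_dn) (i, j)).
by congr (existT C _ (_, _)); apply/eqP; rewrite iter_ordS_fixed.
Qed.

(** * Growth of |U_2n| *)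

Lemma alternating_sum_bounds (R : numDomainType) (T : nat -> R) n :
    (forall k, (k <= n)%N -> 0 <= T k) ->
    (forall k, (k < n)%N -> T k.+1 <= T k) ->
  0 <= \sum_(0 <= k < n.+1) (-1) ^+ k * T k <= T 0%N.
Proof.
elim: n T => [|n IHn] T T_ge0 T_dec; first by rewrite big_nat1 expr0 mul1r lexx andbT T_ge0.
rewrite big_nat_recl // expr0 mul1r.
under eq_bigr => k _ do rewrite exprS mulN1r mulNr.
rewrite sumrN.
have /andP[S_ge0 S_le] : 0 <= \sum_(0 <= k < n.+1) (-1) ^+ k * T k.+1 <= T 1%N.
  by apply: (IHn (T \o S)) => k le_kn; [apply: T_ge0 | apply: T_dec].
by rewrite subr_ge0 (le_trans S_le) ?T_dec // gerBl.
Qed.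

(** The terms after T_0 subtract at most T_1, which is at most T_0 / 2. *)
Lemma alternating_sum_ge_half (T : nat -> int) n :
    (forall k, 0 <= T k) -> (forall k, (k < n)%N -> 2 * T k.+1 <= T k) ->
  T 0%N <= 2 * \sum_(0 <= k < n.+1) (-1) ^+ k * T k.
Proof.
move=> T_ge0; case: n => [|n] T_dec.
  by rewrite big_nat1 expr0 mul1r; have := T_ge0 0%N; lia.
rewrite big_nat_recl // expr0 mul1r.
under eq_bigr => k _ do rewrite exprS mulN1r mulNr.
rewrite sumrN.
have /andP[_ ] : 0 <= \sum_(0 <= k < n.+1) (-1) ^+ k * T k.+1 <= T 1%N.
  apply: (@alternating_sum_bounds _ (T \o S)) => k le_kn; first exact: T_ge0.
  by have := T_dec k.+1 le_kn; have := T_ge0 k.+2; rewrite /=; lia.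
by have := T_dec 0%N isT; move: (\sum_(0 <= k < _) _) => V; lia.
Qed.

(** This is |U_2n|, by the positivity in [absU_growth]. *)
Definition absU n : int := (-1) ^+ n * U (2 * n).

Lemma absU_rec n : absU n.+1 = 2 * \sum_(0 <= k < n.+1)
  (-1) ^+ k * ('C(2 * n.+1, 2 * k.+1)%:Z * absU (n - k)).
Proof.
rewrite /absU U_rec ?muln_gt0 // mul2n doubleK -mul2n big_add1 /= !mulr_sumr.
rewrite !big_nat; apply: eq_bigr => k /= lt_kn.
rewrite (_ : 2 * n.+1 - 2 * k.+1 = 2 * (n - k))%N; last by lia.
have -> : (-1) ^+ n.+1 = - (-1) ^+ k * (-1) ^+ (n - k) :> int.
  by rewrite mulNr -exprD subnKC // exprS mulN1r.
ring.
Qed.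

(** The constant is C(2n+2, 2), so the lower bound is the leading term of the alternating sum in
    [absU_rec]. By induction the terms at least halve at each step, so twice the sum is at least
    that term. *)
Lemma absU_growth n : 0 < absU n /\
  (n.+1 * n.*2.+1)%:Z * absU n <= absU n.+1.
Proof.
have [m] := ubnP n; elim: m n => // m IHm n /ltnSE-le_nm.
have pos k : (k <= n)%N -> 0 < absU k.
  case: k => [|k] lt_kn; first by rewrite /absU mul1r U0.
  have [k_gt0 /(lt_le_trans _)-> //] := IHm k (leq_trans lt_kn le_nm).
  by rewrite mulr_gt0.
split; first exact: pos.
pose T k := 'C(2 * n.+1, 2 * k.+1)%:Z * absU (n - k).
have T_ge0 k : 0 <= T k by rewrite mulr_ge0 // ltW // pos // leq_subr.
have T_dec k : (k < n)%N -> 2 * T k.+1 <= T k.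
  move=> lt_kn; have [_ le_absU] := IHm (n - k.+1)%N ltac:(lia).
  have e1 : ((2 * k + 4) * 'C(2 * n.+1, 2 * k.+2) =
      (2 * n - 2 * k - 1) * 'C(2 * n.+1, (2 * k.+1).+1))%N.
    rewrite (_ : 2 * k + 4 = (2 * k.+1).+2)%N; last by lia.
    rewrite (_ : 2 * k.+2 = (2 * k.+1).+2)%N; last by lia.
    by rewrite mul_bin_left; congr (_ * _)%N; lia.
  have e2 : ((2 * k + 3) * 'C(2 * n.+1, (2 * k.+1).+1) =
      (2 * n - 2 * k) * 'C(2 * n.+1, 2 * k.+1))%N.
    rewrite (_ : 2 * k + 3 = (2 * k.+1).+1)%N; last by lia.
    by rewrite mul_bin_left; congr (_ * _)%N; lia.
  (* The factor (n - k)(2(n - k - 1) + 1) is the growth constant at index n - k - 1, so the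
     induction hypothesis absorbs it. *)
  have e3 : ((2 * k + 4) * (2 * k + 3) * 'C(2 * n.+1, 2 * k.+2) =
      2 * ((n - k) * (n - k.+1).*2.+1) * 'C(2 * n.+1, 2 * k.+1))%N.
    rewrite mulnAC e1 -mulnA (mulnC _ (2 * k + 3)%N) e2 mulnA; congr (_ * _)%N.
    by rewrite mulnC mulnA; congr (_ * _)%N; lia.
  rewrite (_ : (n - k.+1).+1 = n - k)%N in le_absU; last by lia.
  have x_gt0 := pos (n - k.+1)%N (leq_subr _ _).
  rewrite /T; move: x_gt0 le_absU e3; clear.
  move: (absU _) (absU _) ('C(_, _)) ('C(_, _)) => y x D A x_gt0.
  move: ((n - k) * _)%N => r le_xy e3.
  (* Since (2k+4)(2k+3) >= 4, [e3] yields 4 T_(k+1) <= 2 T_k. *)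
  have le_A : 4 * A%:Z <= ((2 * k + 4) * (2 * k + 3) * A)%N%:Z by nia.
  have := ler_wpM2r (ltW x_gt0) le_A; rewrite e3.
  have := ler_wpM2l (le0z_nat D) le_xy; rewrite !PoszM; lia.
rewrite absU_rec.
have T0 : T 0%N = (n.+1 * n.*2.+1)%:Z * absU n.
  rewrite /T subn0 muln1 bin2; congr (Posz _ * _); lia.
by rewrite -T0; apply: alternating_sum_ge_half.
Qed.

(** The two signs agree unless p = 2 and k = 0; then the modulus is 2 and both values are even. *)
Lemma gauss_absU : gauss_congruences absU.
Proof.
move=> p k m p_pr m_gt0.
have U_even n : (0 < n)%N -> (2 %| U n)%Z by move=> n0; rewrite U_rec // dvdz_mulr.
have [p_odd | ] := boolP (odd p || (0 < k))%N.
  have sign_eq : (-1) ^+ (p ^ k.+1 * m) = (-1) ^+ (p ^ k * m) :> int.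
    rewrite -signr_odd -[RHS]signr_odd !oddM !oddX.
    by case: (odd p) p_odd => //=; case: k => //.
  by rewrite /absU sign_eq -mulrBr; apply/dvdz_mull/gauss_U.
rewrite negb_or -leqNgt leqn0 => /andP[p_even /eqP->].
have -> : p = 2 by case: (even_prime p_pr) p_even => ->.
by apply: rpredB; apply/dvdz_mull/U_even; rewrite !muln_gt0.
Qed.

Lemma absU_realizable : realizable absU.
Proof.
have [o o_eq] := gauss_divisor_sum gauss_absU.
(* Each term is at least twice the preceding one, hence dominates the sum of all earlier ones. *)
have sum_le n : \sum_(1 <= d < n.+1) absU d <= absU n.+1.
  elim: n => [|n IHn]; first by rewrite big_geq // ltW // (absU_growth 1).1.
  have [pos growth] := absU_growth n.+1; rewrite big_nat_recr //=.
  have coef_ge2 : 2 <= (n.+2 * n.+1.*2.+1)%:Z by nia.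
  have := le_trans (ler_wpM2r (ltW pos) coef_ge2) growth.
  by rewrite mulr_natl mulr2n; apply: le_trans; apply: lerD.
have o_ge0 n : (0 < n)%N -> 0 <= o n.
  have [m] := ubnP n; elim: m n => // m IHm n /ltnSE-le_nm n_gt0.
  (* The other divisors of d contribute nonnegatively by induction. Hence n o_n is at least b_n
     minus the sum of the b_d with 0 < d < n, which [sum_le] bounds by b_n. *)
  have o_le d : (0 < d < n)%N -> d%:Z * o d <= absU d.
    move=> /andP[d_gt0 lt_dn]; rewrite o_eq // big_mkcond big_nat_recr //= dvdnn.
    rewrite lerDr -big_mkcond big_nat_cond sumr_ge0 // => -[|e] /andP[/andP[_ lt_ed] _].
      by rewrite mul0r.
    by rewrite mulr_ge0 // IHm // (leq_trans _ le_nm) // (leq_trans lt_ed) // ltnW.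
  have := o_eq n n_gt0; rewrite big_mkcond big_nat_recr //= dvdnn => /(canLR (addKr _)) eo.
  rewrite -(pmulr_rge0 _ (_ : 0 < n%:Z)) // -eo addrC subr_ge0.
  case: n n_gt0 {le_nm eo} o_le => // n _ o_le; apply: le_trans (sum_le n).
  rewrite big_ltn //= add0r !big_nat; apply: ler_sum => d lt_dn.
  case: ifP => _; first exact: o_le.
  by have [/ltW] := absU_growth d.
apply: (@orbit_counts_realizable _ (fun d => `|o d|%N)) => n n_gt0.
rewrite o_eq // -natz natr_sum; apply: eq_bigr => -[|d] _.
  by rewrite mul0r mul0n.
by rewrite natz PoszM gez0_abs // o_ge0.
Qed.

Theorem theorem5p1 :
  newton_euler_seq (fun n : nat => U (2 * n)) /\
  realizable (fun n : nat => (-1) ^+ n * U (2 * n)).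
Proof. by split; [apply: gauss_newton_euler gauss_U | exact: absU_realizable]. Qed.
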